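(* Let $n \ge 1$ and let $J$ and $K$ be orthogonal complex structures on $\mathbb{R}^{2n}$. If $J$ and $K$ have opposite sign, then $\dim(\ker(J+K))\equiv 2 \pmod 4$. If $J$ and $K$ have the same sign, then $\dim(\ker(J+K))\equiv 0\pmod 4$.
   Context: A complex structure on $\mathbb{R}^{2n}$ is a real $2n\times 2n$ matrix $J$ with $J^2=-\mathrm{id}$; it is an orthogonal complex structure if in addition $J$ is an orthogonal matrix (equivalently, $J$ is in addition skew-symmetric). Sign of a complex structure $J$: write $\mathbb{R}^{2n}=W_1\oplus\cdots\oplus W_n$ with each $W_k$ a 2-dimensional $J$-invariant subspace (such a decomposition always exists), choose a nonzero $e_k\in W_k$ for each $k$, and let $Q$ be the $2n\times 2n$ matrix with columns $e_1, Je_1,\dots,e_n,Je_n$. The sign of $J$ is the sign of $\det Q$ (this is independent of the choices). *)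

(* Defs.v *)
From mathcomp Require Import all_boot all_order all_algebra.
From mathcomp Require Import boolp classical_sets reals.

Set Implicit Arguments.
Unset Strict Implicit.
Unset Printing Implicit Defensive.

Import Order.TTheory GRing.Theory Num.Theory.

Local Open Scope ring_scope.

(* Matrices act on R^(2n) = 'cV[R]_(2 * n) by left multiplication. *)

Definition complex_structure (R : realType) (n : nat) (J : 'M[R]_(2 * n)) : Prop :=
  J *m J = - 1%:M.

Definition orthogonal_complex_structure (R : realType) (n : nat)
    (J : 'M[R]_(2 * n)) : Prop :=
  complex_structure J /\ J^T *m J = 1%:M.

Definition invariant_plane_decomposition (R : realType) (n : nat)
    (J : 'M[R]_(2 * n)) (W : 'I_n -> {vspace 'cV[R]_(2 * n)}) : Prop :=
  [/\ forall k, \dim (W k) = 2%N,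
      forall k v, v \in W k -> J *m v \in W k,
      directv (\sum_k W k)%VS &
      (\sum_k W k)%VS = fullv].

Lemma half_ord_proof (n : nat) (j : 'I_(2 * n)) : (j./2 < n)%N.
Proof. by rewrite ltn_half_double -mul2n. Qed.

Definition half_ord (n : nat) (j : 'I_(2 * n)) : 'I_n := Ordinal (half_ord_proof j).

(* With 0-based columns, column 2k is e_k and column 2k+1 is J e_k, so the
   columns are, in order, e_1, J e_1, ..., e_n, J e_n. *)
Definition frame_mx (R : realType) (n : nat) (J : 'M[R]_(2 * n))
    (e : 'I_n -> 'cV[R]_(2 * n)) : 'M[R]_(2 * n) :=
  \matrix_(i, j) (if odd j then (J *m e (half_ord j)) i 0 else e (half_ord j) i 0).

Definition is_cs_sign (R : realType) (n : nat) (J : 'M[R]_(2 * n)) (s : R) : Prop :=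
  exists (W : 'I_n -> {vspace 'cV[R]_(2 * n)}) (e : 'I_n -> 'cV[R]_(2 * n)),
    [/\ invariant_plane_decomposition J W,
        forall k, e k \in W k /\ e k != 0 &
        s = Num.sg (\det (frame_mx J e))].

(* The value for an arbitrarily chosen decomposition and choice of the e_k;
   for a complex structure these exist, the value is 1 or -1, and it does not
   depend on the choice. The default 0 is only taken if no decomposition
   exists. *)
Definition cs_sign (R : realType) (n : nat) (J : 'M[R]_(2 * n)) : R :=
  xget 0 [set s | is_cs_sign J s]%classic.

Definition dim_ker (R : realType) (m : nat) (A : 'M[R]_m) : nat :=
  \dim (lker (linfun (mulmx A : 'cV[R]_m -> 'cV[R]_m))).

(* Main.v *)
(* A frame Q of J satisfies J Q = Q J0 for a fixed matrix J0, so the sign of J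
   is the sign of det Q for any invertible Q with J Q = Q J0.  If J + K is
   invertible, then J (J + K) = (J + K) K, the skew matrix J + K has positive
   determinant, and matrices commuting with J0 have nonnegative determinant;
   hence J and K have the same sign.  Otherwise, conjugating K by the reflection
   along a vector v of ker (J + K) replaces K by J on the plane spanned by v and
   J v: this reverses the sign of K and lowers dim ker (J + K) by 2. *)

Require Import Defs.
From mathcomp Require Import all_boot all_order all_algebra.
From mathcomp Require Import boolp classical_sets reals.
From mathcomp Require Import complex ring lra.

Set Implicit Arguments.
Unset Strict Implicit.
Unset Printing Implicit Defensive.

Import Order.TTheory GRing.Theory Num.Theory.

Local Open Scope ring_scope.

(** * Matrices with nonnegative determinant *)

(* Over R[i] the projections P, Q onto the two eigenspaces of J commute with C,
   so C = (C P + Q) (C Q + P); the two factors are complex conjugate, hence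
   det C is a squared modulus. *)
Lemma det_commute_complex_structure_ge0 (R : rcfType) (m : nat) (J C : 'M[R]_m) :
  J *m J = - 1%:M -> C *m J = J *m C -> 0 <= \det C.
Proof.
move=> JJ CJ; pose f : {rmorphism R -> R[i]} := real_complex R.
pose c : {rmorphism R[i] -> R[i]} := @conjc R.
(* [I] is an involution, and [P] and [Q] below project onto its eigenspaces for -1 and 1. The
   conjugation [c] fixes [D] and negates [I], so it swaps [P] and [Q]. *)
pose D := map_mx f C; pose I := 'i%C *: map_mx f J.
have II : I *m I = 1%:M.
  rewrite -scalemxAl -scalemxAr scalerA -expr2 sqr_i -map_mxM JJ.
  by rewrite map_mxN map_mx1 scaleN1r opprK.
have DI : D *m I = I *m D by rewrite -scalemxAr -scalemxAl -!map_mxM CJ.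
have cD : map_mx c D = D.
  by apply/matrixP=> i j; rewrite !mxE; apply: conjc_real.
have cI : map_mx c I = - I.
  apply/matrixP=> i j; rewrite !mxE (rmorphM c) [c (f _)]conjc_real -mulNr.
  by congr (_ * _); simpc.
rewrite -ler0c -[_%:C%C](det_map_mx f) -/D.
clearbody D I.
pose P := 2^-1 *: (1%:M - I); pose Q := 2^-1 *: (1%:M + I).
have c2 : c 2^-1 = 2^-1 by rewrite fmorphV rmorph_nat.
have cP : map_mx c P = Q by rewrite map_mxZ map_mxB cI map_mx1 opprK c2.
have cQ : map_mx c Q = P by rewrite map_mxZ map_mxD cI map_mx1 c2.
have DP : D *m P = P *m D.
  by rewrite -scalemxAr -scalemxAl mulmxBl mulmxBr mul1mx mulmx1 DI.
have PQ1 : P + Q = 1%:M.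
  rewrite -scalerDr addrACA addNr addr0 -[_ + _]/(1%:M *+ 2) -scalerMnr scalerMnl.
  by rewrite -mulr_natr mulVf ?scale1r ?pnatr_eq0.
have PQ0 : P *m Q = 0.
  rewrite -scalemxAl -scalemxAr mulmxBl !mulmxDr !mul1mx mulmx1 II.
  by rewrite (addrC I) subrr !scaler0.
clearbody P Q.
have defQ : Q = 1%:M - P by rewrite -PQ1 addrC addKr.
have PP : P *m P = P.
  by apply/eqP; rewrite eq_sym -subr_eq0 -{1}[P]mulmx1 -mulmxBr -defQ PQ0.
have defD : (D *m P + Q) *m (D *m Q + P) = D.
  have QD : Q *m D = D *m Q by rewrite defQ mulmxBl mulmxBr DP mulmx1 mul1mx.
  have QP : Q *m P = 0 by rewrite defQ mulmxBl mul1mx PP subrr.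
  have QQ : Q *m Q = Q by rewrite {1}defQ mulmxBl mul1mx PQ0 subr0.
  rewrite mulmxDl !mulmxDr QP addr0 -(mulmxA D P) [P *m _]mulmxA -DP.
  rewrite -(mulmxA D P Q) PQ0 !mulmx0 add0r -mulmxA PP mulmxA QD -mulmxA QQ.
  by rewrite -mulmxDr PQ1 mulmx1.
suff -> : \det D = `|\det (D *m P + Q)| ^+ 2 by rewrite exprn_ge0.
rewrite -[in LHS]defD det_mulmx normCK; congr (_ * _).
by rewrite -[RHS](det_map_mx c) map_mxD map_mxM cD cP cQ.
Qed.

Lemma row_mul_tr_eq0 (R : realDomainType) (m : nat) (v : 'rV[R]_m) :
  v *m v^T = 0 -> v = 0.
Proof.
move=> /matrixP/(_ 0 0); rewrite !mxE => /eqP.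
rewrite psumr_eq0 => [/allP v0|i _]; last by rewrite mxE -expr2 sqr_ge0.
apply/rowP=> i; have := v0 i; rewrite mem_index_enum => /(_ isT) /=.
by rewrite !mxE -expr2 sqrf_eq0 => /eqP.
Qed.

Lemma skew_form_eq0 (R : realDomainType) (m : nat) (A : 'M[R]_m) (v : 'rV[R]_m) :
  A^T = - A -> v *m A *m v^T = 0.
Proof.
move=> skA; apply/matrixP=> i j; rewrite !ord1 [RHS]mxE.
have : (v *m A *m v^T)^T 0 0 = (v *m A *m v^T) 0 0 by rewrite mxE.
rewrite !trmx_mul trmxK skA mulmxA mulmxN mulNmx mxE => /eqP.
by rewrite eq_sym -addr_eq0 -mulr2n mulrn_eq0 => /eqP.
Qed.

(* Otherwise \det (t + (1 - t) A), which is \det A at t = 0 and 1 at t = 1,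
   vanishes for some t > 0, although v (t + (1 - t) A) v^T = t v v^T. *)
Lemma det_skew_ge0 (R : rcfType) (m : nat) (A : 'M[R]_m) :
  A^T = - A -> 0 <= \det A.
Proof.
move=> skA; rewrite leNgt; apply/negP=> detA_lt0.
pose p : {poly R} := \det ('X *: 1%:M + (1 - 'X) *: map_mx polyC A).
have pE t : p.[t] = \det (t *: 1%:M + (1 - t) *: A).
  rewrite -[LHS]/(horner_eval t p) -det_map_mx; congr (\det _).
  apply/matrixP=> i j; rewrite !mxE -[LHS]/(horner _ t).
  by case: (i == j); rewrite !hornerE.
have /andP[p0 p1] : (p.[0] <= 0) && (0 <= p.[1]).
  rewrite !pE scale0r add0r subr0 scale1r subrr scale0r addr0 scale1r det1.
  by rewrite ltW //= ler01.
have [t _ /rootP] := poly_ivt ler01 (introT andP (conj p0 p1)).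
rewrite pE => /eqP pt0; have /det0P [v v_neq0 vA0] := pt0.
have : v *m (t *: 1%:M + (1 - t) *: A) *m v^T = 0 by rewrite vA0 mul0mx.
rewrite mulmxDr mulmxDl -!scalemxAr -!scalemxAl mulmx1 skew_form_eq0 //.
rewrite scaler0 addr0 => /eqP; rewrite scaler_eq0 => /orP[/eqP t0|/eqP].
  by move: pt0; rewrite t0 scale0r add0r subr0 scale1r lt_eqF.
by move/row_mul_tr_eq0/eqP; apply/negP.
Qed.

(** * Comparing the determinants of two frames *)

(** The matrix [invmx Q *m ((J + K) *m P)] commutes with [J0], because [J (J + K) = (J + K) K]
    carries [J0] across it. Its determinant is therefore nonnegative, while [\det (J + K)] is
    positive. *)
Lemma sg_det_frame_ker0 (R : rcfType) (m : nat) (J0 J K Q P : 'M[R]_m) :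
  J *m J = - 1%:M -> J^T = - J -> K *m K = - 1%:M -> K^T = - K ->
  J *m Q = Q *m J0 -> \det Q != 0 -> K *m P = P *m J0 -> \det P != 0 ->
  \det (J + K) != 0 -> Num.sg (\det P) = Num.sg (\det Q).
Proof.
move=> JJ skJ KK skK JQ dQ KP dP dS.
have uQ : Q \in unitmx by rewrite unitmxE unitfE.
have defJ0 : J0 = invmx Q *m J *m Q by rewrite -mulmxA JQ mulKmx.
have JJ0 : J0 *m J0 = - 1%:M.
  by rewrite {1}defJ0 -(mulmxA _ Q) -JQ !mulmxA -(mulmxA _ J J) JJ mulmxN mulmx1
    mulNmx mulVmx.
have JS : J *m (J + K) = (J + K) *m K by rewrite mulmxDr mulmxDl JJ KK addrC.
have SP_ge0 : 0 <= \det (invmx Q *m ((J + K) *m P)).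
  apply: (det_commute_complex_structure_ge0 JJ0).
  by rewrite -!mulmxA -KP (mulmxA _ K) -JS {1}defJ0 !mulmxA mulmxK.
have S_gt0 : 0 < \det (J + K).
  by rewrite lt0r dS det_skew_ge0 // linearD /= skJ skK opprD.
move: SP_ge0; rewrite !det_mulmx det_inv.
rewrite mulrCA pmulr_rge0 // => PQ_ge0.
have : 0 < (\det Q)^-1 * \det P by rewrite lt0r mulf_neq0 ?invr_neq0.
by move/gtr0_sg; rewrite sgrM sgrV; case: sgrP dQ; case: sgrP dP => //; lra.
Qed.

(** Two block triangular factorizations of [A] yield the two sides. The formula serves for the
    determinant of a reflection. *)
Lemma det_1_sub_mul (R : comNzRingType) (m : nat) (u : 'cV[R]_m) (v : 'rV[R]_m) :
  \det (1%:M - u *m v) = 1 - (v *m u) 0 0.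
Proof.
pose A := block_mx 1%:M u v (1%:M : 'M_1).
have <- : \det A = \det (1%:M - u *m v).
  have -> : A = block_mx 1%:M u 0 1%:M *m block_mx (1%:M - u *m v) 0 v 1%:M.
    by rewrite mulmx_block !mul1mx !mul0mx !mulmx1 ?addr0 ?add0r subrK.
  by rewrite det_mulmx det_ublock det_lblock !det1 !mul1r mulr1.
have -> : A = block_mx 1%:M 0 v 1%:M *m block_mx 1%:M u 0 (1%:M - v *m u).
  by rewrite mulmx_block !mul1mx !mul0mx !mulmx1 ?mulmx0 ?addr0 addrC subrK.
by rewrite det_mulmx det_lblock det_ublock !det1 !mul1r det_mx11 !mxE eqxx.
Qed.

(* H is the reflection along some v in the kernel: conjugation by it replaces K
   by -K = J on the plane spanned by v and v K, and fixes K on the orthogonal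
   complement. *)
Lemma flip_complex_structure (R : rcfType) (m : nat) (J K : 'M[R]_m) :
  J *m J = - 1%:M -> J^T = - J -> K *m K = - 1%:M -> K^T = - K ->
  \det (J + K) = 0 ->
  exists H : 'M[R]_m, [/\ H *m H = 1%:M, H^T = H, \det H = -1 &
    \rank (kermx (J + K)) = (\rank (kermx (J + H *m K *m H)) + 2)%N].
Proof.
move=> JJ skJ KK skK /eqP/det0P[v v_neq0 vM0].
set M := J + K in vM0 *; pose w := v *m K; pose q := (v *m v^T) 0 0.
have vv : v *m v^T = q%:M by rewrite [LHS]mx11_scalar.
have q_neq0 : q != 0.
  apply: contraNneq v_neq0 => q0; apply/eqP/row_mul_tr_eq0.
  by rewrite vv q0 raddf0.
have skM : M^T = - M by rewrite linearD /= skJ skK opprD.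
have wM0 : w *m M = 0.
  have -> : w *m M = v *m M *m J.
    by rewrite /w /M -!mulmxA mulmxDr mulmxDl KK JJ addrC.
  by rewrite vM0 mul0mx.
have wE : w^T = - (K *m v^T) by rewrite trmx_mul skK mulNmx.
have KvE : K *m v^T = - w^T by rewrite wE opprK.
have vw : v *m w^T = 0 by rewrite wE mulmxN mulmxA skew_form_eq0 ?oppr0.
have wv : w *m v^T = 0 by rewrite skew_form_eq0.
have ww : w *m w^T = q%:M.
  by rewrite wE mulmxN /w -mulmxA (mulmxA K) KK mulNmx mul1mx mulmxN opprK vv.
(* As [q] is the squared length of [v], the factor [2 / q] makes [H] the reflection in the
   hyperplane orthogonal to [v]. *)
pose a := 2 / q; have aq : a * q = 2 by rewrite divfK.
pose H := 1%:M - (a *: v^T) *m v.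
have HH : H *m H = 1%:M.
  rewrite /H; set N := _ *m v.
  have NN : N *m N = N + N.
    rewrite /N -mulmxA (mulmxA v) -scalemxAr vv scale_scalar_mx aq.
    by rewrite mul_scalar_mx -scalemxAr scaler_nat mulr2n.
  by rewrite mulmxBl mul1mx mulmxBr mulmx1 NN opprB addrK subrK.
have trH : H^T = H.
  by rewrite /H -scalemxAl linearB /= linearZ /= trmx_mul trmxK trmx1.
exists H; split=> //.
  rewrite det_1_sub_mul -scalemxAr vv scale_scalar_mx mxE eqxx mulr1n aq; ring.
set M' := J + _.
have defM' : M' = M - a *: (v^T *m w) + a *: (w^T *m v).
  have NK : (a *: v^T) *m v *m K = a *: (v^T *m w) by rewrite -!scalemxAl mulmxA.
  have KN : K *m ((a *: v^T) *m v) = - (a *: (w^T *m v)).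
    by rewrite mulmxA -scalemxAr KvE scalerN mulNmx scalemxAl.
  have NKN : v^T *m w *m (v^T *m v) = 0.
    by rewrite mulmxA -(mulmxA v^T w) wv mulmx0 mul0mx.
  rewrite /M' /H !mulmxBl !mul1mx !mulmxBr !mulmx1 NK KN -!scalemxAl -scalemxAr.
  by rewrite NKN !scaler0 subr0 opprK addrA (addrA J) addrAC.
clearbody M M' w.
have Mv0 : M *m v^T = 0.
  by apply: trmx_inj; rewrite trmx_mul trmxK skM mulmxN vM0 oppr0 trmx0.
have Mw0 : M *m w^T = 0.
  by apply: trmx_inj; rewrite trmx_mul trmxK skM mulmxN wM0 oppr0 trmx0.
(* On the plane of [v^T] and [w^T], the matrix [M'] acts as twice [J]. *)
have M'v : M' *m v^T = 2 *: w^T.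
  rewrite defM' !mulmxDl Mv0 add0r mulNmx -!scalemxAl -!mulmxA wv mulmx0 scaler0.
  by rewrite oppr0 add0r vv mul_mx_scalar scalerA aq.
have M'w : M' *m w^T = - (2 *: v^T).
  rewrite defM' !mulmxDl Mw0 add0r mulNmx -!scalemxAl -!mulmxA vw mulmx0 scaler0.
  by rewrite addr0 ww mul_mx_scalar scalerA aq.
have two_neq0 : (2 : R) != 0 by rewrite pnatr_eq0.
(* Hence rows killed by [M'] are orthogonal to [v] and [w], and on such rows the correction terms of
   [defM'] vanish. *)
have ker_perp p (X : 'M_(p, m)) : X *m M' = 0 ->
    [/\ X *m v^T = 0, X *m w^T = 0 & X *m M = 0].
  move=> XM'0.
  have Xw0 : X *m w^T = 0.
    apply/eqP; rewrite -(inj_eq (scalerI two_neq0)) scaler0 scalemxAr -M'v.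
    by rewrite mulmxA XM'0 mul0mx.
  have Xv0 : X *m v^T = 0.
    apply/eqP; rewrite -(inj_eq (scalerI two_neq0)) scaler0 scalemxAr.
    by rewrite -[X in _ *m X]opprK -M'w mulmxN mulmxA XM'0 mul0mx oppr0.
  split=> //; move: XM'0; rewrite defM' mulmxDr mulmxBr -!scalemxAr !mulmxA.
  by rewrite Xv0 Xw0 !mul0mx scaler0 subr0 addr0.
pose B := col_mx v w.
have BB : B *m B^T = q%:M.
  by rewrite tr_col_mx mul_col_row vv vw wv ww -scalar_mx_block.
have BM0 : B *m M = 0 by rewrite mul_col_mx vM0 wM0 col_mx0.
have rB : \rank B = 2%N.
  apply/eqP; rewrite eqn_leq rank_leq_row /=.
  apply: (@mulmx1_min_rank _ _ _ _ _ (q^-1)%:M B^T).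
  by rewrite -mulmxA BB -scalar_mxM mulVf.
have capB : (kermx M' :&: B = 0)%MS.
  set X := (_ :&: _)%MS.
  have /sub_kermxP/ker_perp[Xv Xw _] : (X <= kermx M')%MS by apply: capmxSl.
  have /submxP[Y defX] : (X <= B)%MS by apply: capmxSr.
  have : X *m B^T = 0 by rewrite tr_col_mx mul_mx_row Xv Xw row_mx0.
  rewrite defX -mulmxA BB mul_mx_scalar => /eqP.
  by rewrite scaler_eq0 (negPf q_neq0) /= => /eqP->; rewrite mul0mx.
have sumB : (kermx M' + B == kermx M)%MS.
  apply/andP; split.
    rewrite addsmx_sub; apply/andP; split; apply/sub_kermxP => //.
    by have [_ _ ->] := ker_perp _ _ (mulmx_ker M').
  set X := kermx M; have XM0 : X *m M = 0 := mulmx_ker M.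
  clearbody X.
  (* [q^-1 *: Z] is the orthogonal projection of the rows of [X] onto the plane of [v] and [w];
     subtracting it leaves rows in the kernel of [M']. *)
  pose Z := X *m v^T *m v + X *m w^T *m w.
  have ZB : (Z <= B)%MS.
    by rewrite -addsmxE addmx_sub_adds ?submxMl.
  have vM' : v *m M' = - (2 *: w).
    rewrite defM' mulmxDr mulmxBr vM0 sub0r -!scalemxAr !mulmxA vv vw.
    by rewrite mul0mx scaler0 addr0 mul_scalar_mx scalerA aq.
  have wM' : w *m M' = 2 *: v.
    rewrite defM' mulmxDr mulmxBr wM0 sub0r -!scalemxAr !mulmxA wv ww.
    by rewrite mul0mx scaler0 oppr0 add0r mul_scalar_mx scalerA aq.
  have ZM' : Z *m M' = q *: (X *m M').
    rewrite mulmxDl -!(mulmxA _ _ M') vM' wM' defM' mulmxDr mulmxBr XM0 sub0r.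
    rewrite mulmxN -!scalemxAr !mulmxA scalerDr scalerN !scalerA.
    by rewrite (mulrC q) aq.
  rewrite -[X](subrK (q^-1 *: Z)) addmx_sub_adds ?scalemx_sub //.
  by apply/sub_kermxP; rewrite mulmxBl -scalemxAl ZM' scalerA mulVf // scale1r subrr.
by rewrite -(eqmx_rank sumB) mxrank_disjoint_sum // rB.
Qed.

(** A flip replaces [K] and [P] by [H K H] and [H P], which negates [\det P] and lowers the rank of
    the kernel by 2; [d] counts the flips made until the sum is invertible. *)
Lemma sg_det_frame (R : rcfType) (m : nat) (J0 J K Q P : 'M[R]_m) :
  J *m J = - 1%:M -> J^T = - J -> K *m K = - 1%:M -> K^T = - K ->
  J *m Q = Q *m J0 -> \det Q != 0 -> K *m P = P *m J0 -> \det P != 0 ->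
  exists d, \rank (kermx (J + K)) = d.*2 /\
    Num.sg (\det P) = (-1) ^+ d * Num.sg (\det Q).
Proof.
move=> JJ skJ + + JQ dQ.
(* Induction on a bound for the rank, with [K] and [P] general since each flip changes both. *)
move: {2}(\rank _).+1 (ltnSn (\rank (kermx (J + K)))) => N.
elim: N K P => // N IH K P; rewrite ltnS => leN KK skK KP dP.
have [S0|S_neq0] := eqVneq (\det (J + K)) 0; last first.
  exists 0; rewrite expr0 mul1r; split; last first.
    exact: (sg_det_frame_ker0 JJ skJ KK skK JQ dQ KP).
  by apply/eqP; rewrite mxrank_ker subn_eq0 row_leq_rank row_free_unit
    unitmxE unitfE.
have [H [HH trH dH rkM]] := flip_complex_structure JJ skJ KK skK S0.
have [|||||d [rkd sgP]] := IH (H *m K *m H) (H *m P).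
- by rewrite rkM addn2 in leN; apply: leq_trans leN.
- by rewrite !mulmxA -(mulmxA _ H H) HH mulmx1 -(mulmxA H) KK mulmxN mulmx1
    mulNmx HH.
- by rewrite !trmx_mul trH skK mulNmx mulmxN mulmxA.
- by rewrite -!mulmxA (mulmxA H H) HH mul1mx KP.
- by rewrite det_mulmx dH mulN1r oppr_eq0.
exists d.+1; rewrite rkM rkd addn2; split=> //.
by rewrite exprS -mulrA -sgP det_mulmx dH !mulN1r sgrN opprK.
Qed.

(** * Kernels on columns and ranks of matrices *)

(** [kermx] is made of row vectors and [dim_ker] of column vectors: transposing a row basis of
    [kermx A^T] gives a basis of the column kernel, and [A] and [A^T] have equal rank. *)
Lemma dim_kerE (R : realType) (m : nat) (A : 'M[R]_m) :
  dim_ker A = \rank (kermx A).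
Proof.
transitivity (\rank (kermx A^T)); last by rewrite !mxrank_ker mxrank_tr.
pose B := row_base (kermx A^T); rewrite /dim_ker; set U := lker _.
pose X := [tuple (row i B)^T | i < \rank (kermx A^T)].
have memU v : (v \in U) = (v^T <= B)%MS.
  rewrite memv_ker lfunE /= eq_row_base sub_kermx -trmx_mul.
  by rewrite trmx_eq0.
have combX (u : 'rV_(\rank (kermx A^T))) : (u *m B)^T = \sum_i u 0 i *: X`_i.
  rewrite mulmx_sum_row linear_sum; apply: eq_bigr => i _ /=.
  by rewrite linearZ (nth_map i) ?size_enum_ord // nth_ord_enum.
apply: (@size_basis _ _ _ _ X); rewrite /basis_of eqEsubv -andbA; apply/and3P; split.
- by apply/span_subvP=> _ /mapP[i _ ->]; rewrite memU trmxK row_sub.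
- apply/subvP=> v; rewrite memU => /submxP[u /(canRL trmxK)->].
  rewrite combX memv_suml // => i _; rewrite memvZ // memv_span // mem_nth //.
  by rewrite size_tuple.
- apply/freeP=> k /eqP.
  rewrite (eq_bigr (fun i => (\row_i k i) 0 i *: X`_i)) => [|i _]; last by rewrite mxE.
  rewrite -combX trmx_eq0 mulmx_free_eq0 ?row_base_free //.
  by move=> /eqP/rowP k0 i; have := k0 i; rewrite !mxE.
Qed.

(** * Existence of invariant plane decompositions *)

Lemma span_mulmx_stable (R : fieldType) (m : nat) (A : 'M[R]_m) (X : seq 'cV[R]_m) :
  {in X, forall v, A *m v \in <<X>>%VS} ->
  {in <<X>>%VS, forall v, A *m v \in <<X>>%VS}.
Proof.
move=> stabX v vX; pose f := linfun (mulmx A : 'cV_m -> 'cV_m).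
have -> : A *m v = f v by rewrite lfunE.
suff /subvP : (f @: <<X>> <= <<X>>)%VS by apply; apply: memv_img.
by rewrite limg_span; apply/span_subvP=> _ /mapP[w wX ->]; rewrite lfunE stabX.
Qed.

(** If [J x = a x + y] with [y] in the span, applying [J] puts [(1 + a ^+ 2) x] in the span, hence
    also [x], since [1 + a ^+ 2] is positive. *)
Lemma free_complex_extend (R : realFieldType) (m : nat) (J : 'M[R]_m)
    (x : 'cV[R]_m) (X : seq 'cV[R]_m) :
  J *m J = - 1%:M -> {in <<X>>%VS, forall y, J *m y \in <<X>>%VS} ->
  free X -> x \notin <<X>>%VS -> free [:: J *m x, x & X].
Proof.
move=> JJ stabX freeX xX; rewrite !free_cons xX freeX !andbT span_cons.
apply/negP=> /memv_addP[_ /vlineP[a ->] [y yX Jx]].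
have JJx : J *m (J *m x) = - x by rewrite mulmxA JJ mulNmx mul1mx.
case/negP: xX.
have : (J *m y + a *: y) \in <<X>>%VS by rewrite memvD ?memvZ ?stabX.
have <- : - (1 + a ^+ 2) *: x = J *m y + a *: y.
  have -> : y = J *m x - a *: x by rewrite Jx addrC addKr.
  rewrite mulmxBr JJx -scalemxAr scalerBr scalerA addrA subrK -expr2.
  by rewrite scaleNr scalerDl scale1r opprD.
have a_neq0 : - (1 + a ^+ 2) != 0.
  by rewrite oppr_eq0 gt_eqF // ltr_pwDl ?sqr_ge0.
by move/(memvZ (- (1 + a ^+ 2))^-1); rewrite scalerA mulVf // scale1r.
Qed.

(** Pairs [x], [J x] are added one at a time: the span so far is stable under [J] and too small to
    be the whole space, so it misses some [x]. *)
Lemma exists_complex_basis (R : realFieldType) (m k : nat) (J : 'M[R]_m) :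
  J *m J = - 1%:M -> (k.*2 <= m)%N ->
  exists2 s : seq 'cV[R]_m, size s = k & free (s ++ map (mulmx J) s).
Proof.
move=> JJ; elim: k => [|k IH] lekm; first by exists [::]; rewrite //= nil_free.
have [|s size_s free_s] := IH; first by apply: leq_trans lekm; rewrite leq_double.
set X := s ++ _ in free_s.
have size_X : size X = k.*2 by rewrite size_cat size_map size_s addnn.
have [x _ xX] : exists2 x, x \in fullv & x \notin <<X>>%VS.
  apply/subvPn/negP=> /dimvS; rewrite dimvf /dim /= muln1.
  by rewrite (eqP free_s) size_X leqNgt (leq_trans _ lekm) // doubleS.
exists (x :: s); first by rewrite /= size_s.
have stabX : {in <<X>>%VS, forall y, J *m y \in <<X>>%VS}.
  apply: span_mulmx_stable => z; rewrite mem_cat => /orP[zs|/mapP[t ts ->]].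
    by rewrite memv_span // mem_cat map_f ?orbT.
  by rewrite mulmxA JJ mulNmx mul1mx memvN memv_span // mem_cat ts.
rewrite (@perm_free _ _ _ [:: J *m x, x & X]) ?(free_complex_extend JJ) //.
exact/permPl/(perm_catCA (x :: s) [:: J *m x]).
Qed.

Lemma exists_invariant_plane_decomposition (R : realType) (n : nat)
    (J : 'M[R]_(2 * n)) :
  complex_structure J -> exists W, invariant_plane_decomposition J W.
Proof.
move=> JJ; have [|s size_s free_s] := @exists_complex_basis _ _ n _ JJ.
  by rewrite mul2n.
pose W (k : 'I_n) := <<[:: s`_k; J *m s`_k]>>%VS; exists W.
have dimW k : (\dim (W k) <= 2)%N by apply: dim_span.
have fullW : (\sum_k W k)%VS = fullv.
  apply/eqP; rewrite eqEdim subvf dimvf /dim /= muln1.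
  apply: leq_trans (dimvS (_ : <<s ++ map (mulmx J) s>> <= _)%VS).
    by rewrite (eqP free_s) size_cat size_map size_s addnn mul2n.
  apply/span_subvP=> v; rewrite mem_cat => vs.
  have [k vk] : exists k, v \in [:: s`_k; J *m s`_k] /\ (k < n)%N.
    case/orP: vs => [|/mapP[w +] ->] => /(nthP 0)[k]; rewrite size_s => ltk <-.
      by exists k; rewrite mem_head.
    by exists k; rewrite !inE eqxx orbT.
  case: vk => vk ltk; rewrite memvE (sumv_sup (Ordinal ltk)) // -memvE.
  exact: memv_span.
(* Each dimension is at most 2, yet they add up to at least [2 * n]; the equality case gives
   dimension 2 for every plane and directness of the sum. *)
have : (\sum_k \dim (W k) <= \sum_(k < n) 2 ?= iff [forall k, \dim (W k) == 2])%N.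
  by apply: leqif_sum => k _; apply/leqif_eq.
have dimfull : \dim {:'cV[R]_(2 * n)} = (\sum_(k < n) 2)%N.
  by rewrite dimvf /dim /= muln1 sum_nat_const card_ord mulnC.
have le_dim : (\dim (\sum_k W k)%VS <= \sum_k \dim (W k))%N by apply: dimv_leq_sum.
rewrite fullW dimfull in le_dim.
case=> le_sum; rewrite eqn_leq le_sum le_dim => /esym/forallP dimW2.
split=> //.
- by move=> k; apply/eqP.
- move=> k v; apply: span_mulmx_stable => {}v; rewrite !inE => /orP[]/eqP->.
    by rewrite memv_span // !inE eqxx orbT.
  by rewrite mulmxA JJ mulNmx mul1mx memvN memv_span ?mem_head.
- by rewrite directvE /= fullW dimfull eqn_leq le_sum le_dim.
Qed.

(** * Frames and the sign *)

(** A row [u] with [u Q = 0] kills every [e k] and [J (e k)], hence every plane [W k] and finally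
    [u^T] itself. *)
Lemma det_frame_mx_neq0 (R : realType) (n : nat) (J : 'M[R]_(2 * n)) W e :
  complex_structure J -> invariant_plane_decomposition J W ->
  (forall k, e k \in W k /\ e k != 0) -> \det (frame_mx J e) != 0.
Proof.
move=> JJ [dimW stabW _ fullW] We; set Q := frame_mx J e.
apply/negP=> /det0P[u u_neq0 uQ0]; case/eqP: u_neq0; apply: row_mul_tr_eq0.
have uW k v : v \in W k -> u *m v = 0.
  have [eW e_neq0] := We k.
  have free_e : free [:: J *m e k; e k].
    apply: (free_complex_extend JJ); rewrite ?nil_free ?span_nil ?memv0 //.
    by by move=> y; rewrite memv0 => /eqP->; rewrite mulmx0 mem0v.
  have <- : <<[:: J *m e k; e k]>>%VS = W k.
    apply/eqP; rewrite eqEdim dimW (eqP free_e) andbT; apply/span_subvP=> w.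
    by rewrite !inE => /orP[]/eqP->; rewrite ?stabW.
  have uQ j : u *m col j Q = 0 by rewrite colE mulmxA uQ0 mul0mx.
  have lt1 : (k.*2.+1 < 2 * n)%N by rewrite mul2n -doubleS leq_double.
  have half1 : half_ord (Ordinal lt1) = k.
    by apply: val_inj; rewrite /= uphalf_double.
  have half0 : half_ord (Ordinal (ltnW lt1)) = k.
    by apply: val_inj; rewrite /= doubleK.
  have Qe : col (Ordinal (ltnW lt1)) Q = e k.
    by apply/colP=> i; rewrite !mxE /= odd_double half0.
  have QJe : col (Ordinal lt1) Q = J *m e k.
    by apply/colP=> i; rewrite !mxE /= odd_double half1.
  pose f := linfun (mulmx u : 'cV_(2 * n) -> 'cV_1).
  suff : (<<[:: J *m e k; e k]>> <= lker f)%VS.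
    by move/subvP=> sub /sub; rewrite memv_ker lfunE => /eqP.
  apply/span_subvP=> w; rewrite memv_ker lfunE /= !inE => /orP[]/eqP->.
    by rewrite -QJe uQ.
  by rewrite -Qe uQ.
have /memv_sumP[v vW ->] : u^T \in (\sum_k W k)%VS by rewrite fullW memvf.
by rewrite mulmx_sumr big1 // => k _; apply: uW (vW _ _).
Qed.

(* The matrix J0 of J in the basis e_1, J e_1, ..., e_n, J e_n. *)
Definition std_cs (R : realType) (n : nat) : 'M[R]_(2 * n) :=
  \matrix_(i, j)
    (if odd j then - ((i : nat) == j.-1)%:R else ((i : nat) == j.+1)%:R).

Lemma mul_frame_mx (R : realType) (n : nat) (J : 'M[R]_(2 * n)) e :
  complex_structure J -> J *m frame_mx J e = frame_mx J e *m std_cs R n.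
Proof.
move=> JJ; apply/matrixP=> i j.
have -> : (J *m frame_mx J e) i j =
    (J *m (if odd j then J *m e (half_ord j) else e (half_ord j))) i 0.
  by rewrite !mxE; apply: eq_bigr => l _; rewrite !mxE; case: odd; rewrite ?mxE.
(* Each column of [std_cs] has a single nonzero entry, so the sum in the product collapses to one
   term. *)
have sumE (l : 'I_(2 * n)) (F c : 'I_(2 * n) -> R) :
    (forall l' : 'I_(2 * n), F l' = (l' == l)%:R * c l') -> \sum_l' F l' = c l.
  move=> FE; rewrite (bigD1 l) //= big1 ?addr0 ?FE ?eqxx ?mul1r // => l' /negPf.
  by rewrite FE => ->; rewrite mul0r.
have jE := odd_double_half j.
rewrite [RHS]mxE; case: ifPn => j_odd.
  rewrite j_odd add1n in jE.
  have ltj : (j.-1 < 2 * n)%N by apply: leq_ltn_trans (leq_pred _) _.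
  have halfE : half_ord (Ordinal ltj) = half_ord j.
    by apply: val_inj; rewrite /= -jE /= doubleK uphalf_double.
  rewrite mulmxA JJ mulNmx mul1mx mxE.
  rewrite (sumE (Ordinal ltj) _ (fun l => - frame_mx J e i l)) => [|l].
    by rewrite mxE halfE /= -jE /= odd_double.
  by rewrite [std_cs _ _ _ _]mxE j_odd mulrN mulrN mulrC.
rewrite (negPf j_odd) add0n in jE.
have ltj : (j.+1 < 2 * n)%N.
  by rewrite -jE [leqRHS]mul2n -doubleS leq_double (ltn_ord (half_ord j)).
have halfE : half_ord (Ordinal ltj) = half_ord j.
  by apply: val_inj; rewrite /= -jE /= doubleK uphalf_double.
rewrite (sumE (Ordinal ltj) _ (fun l => frame_mx J e i l)) => [|l].
  by rewrite [frame_mx _ _ _ _]mxE halfE /= j_odd.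
by rewrite [std_cs _ _ _ _]mxE (negPf j_odd) mulrC.
Qed.

(** [std_cs] does not depend on [J], so the frames of two complex structures can be compared through
    [sg_det_frame]. *)
Lemma cs_signE (R : realType) (n : nat) (J : 'M[R]_(2 * n)) :
  complex_structure J -> exists Q : 'M[R]_(2 * n),
  [/\ J *m Q = Q *m std_cs R n, \det Q != 0 & cs_sign J = Num.sg (\det Q)].
Proof.
move=> JJ; have : is_cs_sign J (cs_sign J).
  (* A decomposition exists, so [xget] does not fall back on its default 0. *)
  rewrite /cs_sign; apply: (@xgetPex _ 0 [set s | is_cs_sign J s]%classic).
  have [W decW] := exists_invariant_plane_decomposition JJ.
  have [dimW _ _ _] := decW.
  pose e k := vpick (W k); exists (Num.sg (\det (frame_mx J e))), W, e.
  split=> // k; split; first exact: memv_pick.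
  by rewrite vpick0 -dimv_eq0 dimW.
move=> [W [e [decW We ->]]]; exists (frame_mx J e); split=> //.
  exact: mul_frame_mx.
exact: det_frame_mx_neq0 We.
Qed.

Theorem corollary5p9 (R : realType) (n : nat) (hn : (1 <= n)%N)
    (J K : 'M[R]_(2 * n))
    (hJ : orthogonal_complex_structure J)
    (hK : orthogonal_complex_structure K) :
  (cs_sign J = - cs_sign K -> dim_ker (J + K) = 2 %[mod 4]) /\
  (cs_sign J = cs_sign K -> dim_ker (J + K) = 0 %[mod 4]).
Proof.
have skew (A : 'M[R]_(2 * n)) : orthogonal_complex_structure A -> A^T = - A.
  (* Multiplying [A^T A = 1] by [A] on the right gives [- A^T = A]. *)
  move=> [AA trA]; have := congr1 (mulmx^~ A) trA.
  by rewrite -mulmxA AA mulmxN mulmx1 mul1mx => /eqP; rewrite eqr_oppLR => /eqP.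
have skJ := skew _ hJ; have skK := skew _ hK.
have [[JJ _] [KK _]] := (hJ, hK).
have [Q [JQ dQ ->]] := cs_signE JJ; have [P [KP dP ->]] := cs_signE KK.
have [d [rkM ->]] := sg_det_frame JJ skJ KK skK JQ dQ KP dP.
rewrite dim_kerE rkM.
have sQ : Num.sg (\det Q) != 0 by rewrite sgr_eq0.
(* Both the sign and [d.*2] modulo 4 depend only on the parity of [d]; the wrong parity would make
   [Num.sg (\det Q)] equal to its opposite. *)
rewrite -signr_odd -(odd_double_half d) oddD odd_double addbF.
case: (odd d) => /=; rewrite ?expr1 ?expr0 ?mulN1r ?mul1r ?opprK; split => // sE.
- by rewrite addnC doubleD -!muln2 -mulnA modnMDl.
- by case/eqP: sQ; move: sE; lra.
- by case/eqP: sQ; move: sE; lra.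
- by rewrite add0n -!muln2 -mulnA modnMl.
Qed.
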